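(* Consider an AC/DC network with a directed converter set $\mathcal{C}$, and let $(\mathcal{P},\mathcal{G})$ be the associated directed graph of AC and DC subgrids. If $(\mathcal{P},\mathcal{G})$ is a directed acyclic graph, then the linear AC/DC grid model of the network, with the AC and DC subgrids as its subsystems, is poset-causal.
   Context: **Network.** $\mathcal{N}^{\mathrm{A}}$ and $\mathcal{N}^{\mathrm{D}}$ are disjoint finite sets of AC and DC buses. $\mathcal{E}^{\mathrm{A}}$ (AC lines) is a set of undirected edges between AC buses and $\mathcal{E}^{\mathrm{D}}$ (DC lines) is a set of undirected edges between DC buses. $\mathcal{C}$ is a set of directed edges (converters), each having one endpoint in $\mathcal{N}^{\mathrm{A}}$ and the other in $\mathcal{N}^{\mathrm{D}}$ (in either order), such that $ij\in\mathcal{C}$ implies $ji\notin\mathcal{C}$. The AC subgrids are the connected components of $(\mathcal{N}^{\mathrm{A}},\mathcal{E}^{\mathrm{A}})$ and the DC subgrids are the connected components of $(\mathcal{N}^{\mathrm{D}},\mathcal{E}^{\mathrm{D}})$. $\mathcal{P}$ is the set of all AC and DC subgrids. For $k,l\in\mathcal{P}$, the directed edge $kl$ is in $\mathcal{G}$ if and only if there is a converter $ij\in\mathcal{C}$ with bus $i$ in subgrid $k$ and bus $j$ in subgrid $l$. The direction of a converter does not affect the physics below except for naming and sign conventions, and for which subgrid its control input is assigned to. **Linear AC/DC grid model.** Each converter $e\in\mathcal{C}$ has one scalar control input $\zeta_e$. The states are the angle $\theta_i$ and frequency $\omega_i$ for each $i\in\mathcal{N}^{\mathrm{A}}$, the voltage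 $v_i$ for each $i\in\mathcal{N}^{\mathrm{D}}$, and one current for each DC line, written $i_{ij}$ with the convention $i_{ji}=-i_{ij}$. For $i\in\mathcal{N}^{\mathrm{A}}$, $$\dot\theta_i=\omega_i,\qquad J_i\dot\omega_i=P_i-D_i\omega_i-\sum_{j:\,ij\in\mathcal{E}^{\mathrm{A}}}B_{ij}(\theta_i-\theta_j)-\sum_{j:\,ij\in\mathcal{C}}\hat v_j\zeta_{ij}+\sum_{j:\,ji\in\mathcal{C}}\hat v_j\zeta_{ji}.$$ For $i\in\mathcal{N}^{\mathrm{D}}$, $$C_i\dot v_i=-\sum_{j:\,ij\in\mathcal{E}^{\mathrm{D}}}i_{ij}-\sum_{j:\,ij\in\mathcal{C}}\zeta_{ij}+\sum_{j:\,ji\in\mathcal{C}}\zeta_{ji}.$$ For each DC line $ij\in\mathcal{E}^{\mathrm{D}}$, $$L_{ij}\dot i_{ij}=v_i-v_j-R_{ij}i_{ij}.$$ Here $J_i,C_i,L_{ij}>0$ and $D_i,B_{ij},R_{ij},\hat v_j$ are real constants, with $B_{ij}=B_{ji}$, $L_{ij}=L_{ji}$, $R_{ij}=R_{ji}$. The $P_i$ (generation or load) are exogenous, not control inputs. The model thus has the form $\dot x=Ax+Bu+Fw$ with $x$ the vector of all states, $u=(\zeta_e)_{e\in\mathcal{C}}$, and $w$ exogenous. **Subsystems.** The subsystems are the elements of $\mathcal{P}$. The states of an AC subgrid are $\theta_i,\omega_i$ for its buses $i$; the states of a DC subgrid are $v_i$ for its buses $i$ and the currents of its lines. The input $\zeta_{ij}$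 of converter $ij\in\mathcal{C}$ is assigned to the subgrid containing the tail bus $i$. This partitions $x$ and $u$ into blocks indexed by $\mathcal{P}$ (some input blocks may be empty). **Poset-causality.** Let $P_{22}(s)=(sI-A)^{-1}B$, with rows partitioned by subsystem states and columns by subsystem inputs; $(P_{22})_{lk}$ is the block with rows in subsystem $l$ and columns in subsystem $k$. The system is poset-causal if there is a partial order $\preceq$ on the set of subsystems $\mathcal{P}$ such that $(P_{22})_{lk}=0$ (as a matrix of rational functions of $s$) whenever $k\not\preceq l$. *)

(* Defs.v *)
From HB Require Import structures.
From mathcomp Require Import all_boot all_order all_algebra ring reals.
From mathcomp Require boolp.

Set Implicit Arguments.
Unset Strict Implicit.
Unset Printing Implicit Defensive.

Import Order.TTheory GRing.Theory Num.Theory.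
Local Open Scope ring_scope.

(* Edge sets are boolean relations, undirected ones being symmetric and
   loopless; the bus set is the disjoint sum of the AC and the DC buses. *)
Record network := Network {
  acbus : finType;
  dcbus : finType;
  acline : rel acbus;
  dcline : rel dcbus;
  conv : rel (acbus + dcbus)%type;
  acline_sym : symmetric acline;
  acline_irr : irreflexive acline;
  dcline_sym : symmetric dcline;
  dcline_irr : irreflexive dcline;
  conv_bipartite : forall i j, conv i j ->
    match i, j with
    | inl _, inr _ | inr _, inl _ => true
    | _, _ => false
    end;
  conv_asym : forall i j, conv i j -> ~~ conv j i
}.

Definition bus (N : network) : finType := (acbus N + dcbus N)%type.

Definition converter (N : network) : finType :=
  {e : bus N * bus N | conv e.1 e.2}.

(* The reference orientation of the DC line between i and j is the one going
   from the bus of smaller rank to the bus of larger rank: each undirected line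
   is represented exactly once. *)
Definition dcedge (N : network) : finType :=
  {e : dcbus N * dcbus N |
    dcline e.1 e.2 && (enum_rank e.1 < enum_rank e.2)%N}.

Section Subgrids.
Variable N : network.

Definition components (T : finType) (e : rel T) : {set {set T}} :=
  equivalence_partition (connect e) [set: T].

Definition acsubgrids : {set {set bus N}} :=
  [set (@inl (acbus N) (dcbus N)) @: K | K : {set acbus N}
    in components (@acline N)].

Definition dcsubgrids : {set {set bus N}} :=
  [set (@inr (acbus N) (dcbus N)) @: K | K : {set dcbus N}
    in components (@dcline N)].

Definition subgrid : finType :=
  {k : {set bus N} | k \in acsubgrids :|: dcsubgrids}.

Definition subgrid_graph : rel subgrid := fun k l =>
  [exists i in val k, exists j in val l, conv i j].

End Subgrids.

Definition is_dag (T : finType) (e : rel T) : Prop :=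
  forall c : seq T, cycle e c -> c = [::].

Inductive state (N : network) :=
  | Angle of acbus N
  | Freq of acbus N
  | Volt of dcbus N
  | Curr of dcedge N.

Section StateFinite.
Variable N : network.

Definition state_encode (s : state N) :
    (acbus N + acbus N + (dcbus N + dcedge N))%type :=
  match s with
  | Angle i => inl (inl i)
  | Freq i => inl (inr i)
  | Volt i => inr (inl i)
  | Curr e => inr (inr e)
  end.

Definition state_decode
    (t : (acbus N + acbus N + (dcbus N + dcedge N))%type) : state N :=
  match t with
  | inl (inl i) => Angle i
  | inl (inr i) => Freq i
  | inr (inl i) => Volt i
  | inr (inr e) => Curr e
  end.

Lemma state_encodeK : cancel state_encode state_decode.
Proof. by case. Qed.

HB.instance Definition _ := Finite.copy (state N) (can_type state_encodeK).

End StateFinite.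

(* Line constants are functions of pairs of buses, relevant only on lines. *)
Record constants (R : realType) (N : network) := Constants {
  cJ : acbus N -> R;
  cD : acbus N -> R;
  cB : acbus N -> acbus N -> R;
  cC : dcbus N -> R;
  cL : dcbus N -> dcbus N -> R;
  cR : dcbus N -> dcbus N -> R;
  vhat : dcbus N -> R;
  cJ_gt0 : forall i, 0 < cJ i;
  cC_gt0 : forall i, 0 < cC i;
  cL_gt0 : forall i j, dcline i j -> 0 < cL i j;
  cB_sym : forall i j, acline i j -> cB i j = cB j i;
  cL_sym : forall i j, dcline i j -> cL i j = cL j i;
  cR_sym : forall i j, dcline i j -> cR i j = cR j i
}.

Section GridModel.
Variables (R : realType) (N : network) (c : constants R N).

Implicit Types (x : state N -> R) (u : converter N -> R) (w : acbus N -> R).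

Definition zeta u (i j : bus N) : R := oapp u 0 (insub (i, j)).

(* The signed current i_ij: on a DC line exactly one of (i, j) and (j, i) is the
   reference orientation, so only one of the two terms is a state. *)
Definition curr x (i j : dcbus N) : R :=
  oapp (x \o @Curr N) 0 (insub (i, j)) - oapp (x \o @Curr N) 0 (insub (j, i)).

(* Time derivative of each state, for states x, control inputs u and exogenous
   inputs w = (P_i). *)
Definition vector_field x u w (s : state N) : R :=
  match s with
  | Angle i => x (Freq i)
  | Freq i =>
      (cJ c i)^-1 *
      (w i - cD c i * x (Freq i)
       - \sum_(j | acline i j) cB c i j * (x (Angle i) - x (Angle j))
       - \sum_(j | conv (inl i) (inr j)) vhat c j * zeta u (inl i) (inr j)
       + \sum_(j | conv (inr j) (inl i)) vhat c j * zeta u (inr j) (inl i))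
  | Volt i =>
      (cC c i)^-1 *
      (- \sum_(j | dcline i j) curr x i j
       - \sum_(j | conv (inr i) (inl j)) zeta u (inr i) (inl j)
       + \sum_(j | conv (inl j) (inr i)) zeta u (inl j) (inr i))
  | Curr e =>
      let: (i, j) := val e in
      (cL c i j)^-1 * (x (Volt i) - x (Volt j) - cR c i j * x (Curr e))
  end.

Definition unit_at (T : finType) (n : 'I_#|T|) : T -> R :=
  fun t => (t == enum_val n)%:R.

(* The vector field is linear: the matrices of x' = A x + B u + F w have as
   columns its values at the unit vectors (see vector_fieldE). *)
Definition gridA : 'M[R]_#|{: state N}| :=
  \matrix_(r, k) vector_field (unit_at k) (fun=> 0) (fun=> 0) (enum_val r).

Definition gridB : 'M[R]_(#|{: state N}|, #|{: converter N}|) :=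
  \matrix_(r, k) vector_field (fun=> 0) (unit_at k) (fun=> 0) (enum_val r).

Definition gridF : 'M[R]_(#|{: state N}|, #|{: acbus N}|) :=
  \matrix_(r, k) vector_field (fun=> 0) (fun=> 0) (unit_at k) (enum_val r).

Definition colvec (T : finType) (f : T -> R) : 'cV[R]_#|T| :=
  \col_n f (enum_val n).

End GridModel.

Section Blocks.
Variable N : network.

Definition state_block (k : subgrid N) : {set state N} :=
  [set s | match s with
           | Angle i | Freq i => inl i \in val k
           | Volt i => inr i \in val k
           | Curr e => (inr (val e).1 \in val k) && (inr (val e).2 \in val k)
           end].

(* A converter's input belongs to the subgrid of its tail. *)
Definition input_block (k : subgrid N) : {set converter N} :=
  [set e | (val e).1 \in val k].

End Blocks.

Section PosetCausal.
Variables (R : fieldType).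

(* (s I - A)^-1 over the field of rational functions in s; the matrix inverted
   is the characteristic matrix of A, always invertible (see resolvent_unit). *)
Definition char_frac_mx n (A : 'M[R]_n) : 'M[{fraction {poly R}}]_n :=
  map_mx (@tofrac {poly R}) ('X%:M - map_mx polyC A).

Definition transfer_mx n m (A : 'M[R]_n) (B : 'M[R]_(n, m)) :
    'M[{fraction {poly R}}]_(n, m) :=
  invmx (char_frac_mx A) *m map_mx (@tofrac {poly R} \o polyC) B.

Definition block (F : Type) (X U : finType) (P : 'M[F]_(#|X|, #|U|))
    (Xl : {set X}) (Uk : {set U}) : 'M[F]_(#|Xl|, #|Uk|) :=
  \matrix_(i, j) P (enum_rank (enum_val i)) (enum_rank (enum_val j)).

Definition poset_causal (K X U : finType)
    (xblock : K -> {set X}) (ublock : K -> {set U})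
    (A : 'M[R]_#|X|) (B : 'M[R]_(#|X|, #|U|)) : Prop :=
  exists le : rel K,
    [/\ reflexive le, antisymmetric le, transitive le &
        forall k l, ~~ le k l ->
          block (transfer_mx A B) (xblock l) (ublock k) = 0].

Lemma resolvent_unit n (A : 'M[R]_n) : char_frac_mx A \in unitmx.
Proof.
rewrite unitmxE det_map_mx unitfE tofrac_eq0.
exact: monic_neq0 (char_poly_monic A).
Qed.

End PosetCausal.

(* The encoding is consistent: currents have the right sign, A, B and F
   represent the vector field, and the blocks partition states and inputs. *)
Section Consistency.
Variables (R : realType) (N : network).

Lemma curr_antisym (x : state N -> R) i j : curr x j i = - curr x i j.
Proof. by rewrite /curr opprB. Qed.

Lemma curr_dcedge (x : state N -> R) (e : dcedge N) :
  curr x (val e).1 (val e).2 = x (Curr e).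
Proof.
rewrite /curr -surjective_pairing valK /= insubN ?subr0 //=.
by case/andP: (valP e) => _; rewrite negb_and -leqNgt orbC => /ltnW ->.
Qed.

Let zeta_lin (a : R) (u u' : converter N -> R) i j :
  zeta (fun t => a * u t + u' t) i j = a * zeta u i j + zeta u' i j.
Proof. by rewrite /zeta; case: insub => //=; rewrite mulr0 addr0. Qed.

Let curr_lin (a : R) (x x' : state N -> R) i j :
  curr (fun t => a * x t + x' t) i j = a * curr x i j + curr x' i j.
Proof. by rewrite /curr; case: insub => [?|]; case: insub => [?|] /=; ring. Qed.

Let sum_lin (I : finType) (P : pred I) (a : R) (f g h : I -> R) :
    (forall i, h i = a * f i + g i) ->
  \sum_(i | P i) h i = a * \sum_(i | P i) f i + \sum_(i | P i) g i.
Proof. by move=> fgh; rewrite mulr_sumr -big_split; apply: eq_bigr. Qed.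

Lemma vector_field_lin (c : constants R N) (a : R) x u w x' u' w' s :
  vector_field c (fun t => a * x t + x' t) (fun t => a * u t + u' t)
    (fun t => a * w t + w' t) s
  = a * vector_field c x u w s + vector_field c x' u' w' s.
Proof.
case: s => [i|i|i|[[i j] ij]] /=; [by [] | | | by ring].
- pose xl y j : R := cB c i j * (y (Angle i) - y (Angle j)).
  have xE j : xl (fun t => a * x t + x' t) j = a * xl x j + xl x' j.
    by rewrite /xl; ring.
  pose ul v (p q : dcbus N -> bus N) j : R := vhat c j * zeta v (p j) (q j).
  have uE p q j :
      ul (fun t => a * u t + u' t) p q j = a * ul u p q j + ul u' p q j.
    by rewrite /ul zeta_lin; ring.
  rewrite (sum_lin _ xE) (sum_lin _ (uE (fun=> inl i) inr)).
  rewrite (sum_lin _ (uE inr (fun=> inl i))) /xl /ul.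
  by ring.
- rewrite (sum_lin _ (curr_lin a x x' i)).
  rewrite (sum_lin _ (fun j => zeta_lin a u u' (inr i) (inl j))).
  rewrite (sum_lin _ (fun j => zeta_lin a u u' (inl j) (inr i))).
  by ring.
Qed.

Let vector_field0 (c : constants R N) s :
  vector_field c (fun=> 0) (fun=> 0) (fun=> 0) s = 0.
Proof.
have z0 (T : Type) : (fun _ : T => -1 * 0 + 0 : R) = fun=> 0.
  by apply: boolp.funext => t; rewrite mulr0 addr0.
have := vector_field_lin c (-1) (fun=> 0) (fun=> 0) (fun=> 0)
  (fun=> 0) (fun=> 0) (fun=> 0) s.
by rewrite !z0 mulN1r addNr.
Qed.

Let unit_sum (T : finType) (f : T -> R) t :
  \sum_n f (enum_val n) * unit_at R n t = f t.
Proof.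
rewrite (bigD1 (enum_rank t)) //= /unit_at enum_rankK eqxx mulr1 big1 ?addr0 //.
move=> n nt; case: eqP => [tn|_]; last by rewrite mulr0.
by case/eqP: nt; rewrite tn enum_valK.
Qed.

Let colvec_lin (S T : finType) (L : (T -> R) -> S -> R) (f : T -> R) :
    (forall s, L (fun=> 0) s = 0) ->
    (forall a g h s, L (fun t => a * g t + h t) s = a * L g s + L h s) ->
  colvec (L f) =
    (\matrix_(r, k) L (unit_at R k) (enum_val r)) *m colvec f.
Proof.
move=> L0 Llin; apply/colP => r; rewrite !mxE.
have fE : (fun t => \sum_n f (enum_val n) * unit_at R n t) = f.
  by apply: boolp.funext => t; rewrite unit_sum.
transitivity (\sum_n f (enum_val n) * L (unit_at R n) (enum_val r)); last first.
  by apply: eq_bigr => k _; rewrite !mxE mulrC.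
rewrite -[in LHS]fE; elim: (index_enum _) => [|n s IHs].
  rewrite big_nil -[RHS](L0 (enum_val r)); congr (L _ _).
  by apply: boolp.funext => t; rewrite big_nil.
rewrite big_cons -IHs -Llin; congr (L _ _).
by apply: boolp.funext => t; rewrite big_cons.
Qed.

Lemma vector_fieldE (c : constants R N) x u w :
  colvec (vector_field c x u w) =
    gridA c *m colvec x + gridB c *m colvec u + gridF c *m colvec w.
Proof.
pose V := vector_field c.
have z0 (T : Type) (a : R) : (fun _ : T => a * 0 + 0 : R) = fun=> 0.
  by apply: boolp.funext => t; rewrite mulr0 addr0.
rewrite -(colvec_lin (L := fun y => V y (fun=> 0) (fun=> 0))); first last.
- by move=> a g h s; rewrite -vector_field_lin !z0.
- exact: vector_field0.
rewrite -(colvec_lin (L := fun v => V (fun=> 0) v (fun=> 0))); first last.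
- by move=> a g h s; rewrite -vector_field_lin !z0.
- exact: vector_field0.
rewrite -(colvec_lin (L := fun p => V (fun=> 0) (fun=> 0) p)); first last.
- by move=> a g h s; rewrite -vector_field_lin !z0.
- exact: vector_field0.
apply/colP => r; rewrite !mxE; move: (enum_val r) => s.
rewrite -[V x _ _ s]mul1r -vector_field_lin.
rewrite -[vector_field c _ _ _ _ in RHS]mul1r -vector_field_lin.
by congr (vector_field c _ _ _ s); apply: boolp.funext => t;
  rewrite ?mul1r ?add0r ?addr0 ?mul1r ?add0r ?addr0.
Qed.

Let componentsP (T : finType) (e : rel T) : symmetric e ->
  forall x, exists2 K, K \in components e &
    forall L, L \in components e -> (x \in L) = (L == K).
Proof.
move=> /sym_connect_sym esym x.
exists [set y in [set: T] | connect e x y]; first by rewrite imset_f ?inE.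
move=> _ /imsetP[z _ ->]; rewrite !inE /=; apply/idP/eqP => [zx|/setP/(_ x)].
  by apply/setP => y; rewrite !inE (same_connect esym zx).
by rewrite !inE connect0 /= => ->.
Qed.

Lemma bus_subgrid (b : bus N) :
  exists k : subgrid N, forall l : subgrid N, (b \in val l) = (l == k).
Proof.
case: b => i.
- have [K Kc KP] := componentsP (@acline_sym N) i.
  have Ks : (@inl _ (dcbus N)) @: K \in acsubgrids N :|: dcsubgrids N.
    by rewrite inE imset_f.
  exists (exist (fun k => k \in acsubgrids N :|: dcsubgrids N) _ Ks).
  move=> [l ls]; rewrite -val_eqE /=.
  case/setUP: (ls) => /imsetP[L Lc ->].
    rewrite (mem_imset _ _ inl_inj) KP //.
    by rewrite (inj_eq (imset_inj inl_inj)).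
  have /negbTE -> : inl i \notin (@inr (acbus N) _) @: L by apply/imsetP => -[].
  apply/esym/negP => /eqP/setP/(_ (inl i)).
  rewrite (mem_imset _ _ inl_inj) (KP K) // eqxx => /imsetP[] //.
- have [K Kc KP] := componentsP (@dcline_sym N) i.
  have Ks : (@inr (acbus N) _) @: K \in acsubgrids N :|: dcsubgrids N.
    by rewrite inE [X in _ || X]imset_f ?orbT.
  exists (exist (fun k => k \in acsubgrids N :|: dcsubgrids N) _ Ks).
  move=> [l ls]; rewrite -val_eqE /=.
  case/setUP: (ls) => /imsetP[L Lc ->]; last first.
    rewrite (mem_imset _ _ inr_inj) KP //.
    by rewrite (inj_eq (imset_inj inr_inj)).
  have /negbTE -> : inr i \notin (@inl _ (dcbus N)) @: L by apply/imsetP => -[].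
  apply/esym/negP => /eqP/setP/(_ (inr i)).
  rewrite (mem_imset _ _ inr_inj) (KP K) // eqxx => /imsetP[] //.
Qed.

Lemma dcline_subgrid (k : subgrid N) i j :
  dcline i j -> (inr i \in val k) = (inr j \in val k).
Proof.
move=> ij; case/setUP: (valP k) => /imsetP[L Lc ->].
  by transitivity false; [|symmetry]; apply/imsetP => -[].
rewrite !(mem_imset _ _ inr_inj); case/imsetP: Lc => z _ ->; rewrite !inE /=.
exact: same_connect1r (sym_connect_sym (@dcline_sym N)) _ _ ij z.
Qed.

Lemma state_block_partition (s : state N) :
  exists k : subgrid N, forall l, (s \in state_block l) = (l == k).
Proof.
case: s => [i|i|i|e].
- by have [k kP] := bus_subgrid (inl i); exists k => l; rewrite inE.
- by have [k kP] := bus_subgrid (inl i); exists k => l; rewrite inE.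
- by have [k kP] := bus_subgrid (inr i); exists k => l; rewrite inE.
have [k kP] := bus_subgrid (inr (val e).1); exists k => l.
by case/andP: (valP e) => eN _; rewrite inE -(dcline_subgrid l eN) andbb.
Qed.

Lemma input_block_partition (e : converter N) :
  exists k : subgrid N, forall l, (e \in input_block l) = (l == k).
Proof.
by have [k kP] := bus_subgrid (val e).1; exists k => l; rewrite inE.
Qed.

End Consistency.

(* Main.v *)
Require Import Defs.
From mathcomp Require Import all_boot all_order all_algebra reals.

Set Implicit Arguments.
Unset Strict Implicit.
Unset Printing Implicit Defensive.

Import GRing.Theory.
Local Open Scope ring_scope.

(** The order is reachability in the graph of subgrids: always a preorder, and
    antisymmetric because two distinct subgrids reachable from each other would
    lie on a directed cycle ([connect_dag_anti]).

    Lines never join two different subgrids, so without inputs every subgrid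
    evolves on its own: A is block diagonal ([vector_field_state_local]), and so
    is (s I - A)^-1.  A converter input acts only on the two subgrids at its
    ends ([vector_field_input_local]), so B has nonzero blocks only there, and
    multiplying by a block diagonal resolvent creates no others
    ([transfer_mx_decoupled]).  Hence the inputs of k reach only k itself, which
    contains the tails of its converters, and the subgrids containing the
    heads, which are the successors of k in the graph. *)

Lemma connect_dag_anti (T : finType) (e : rel T) :
  is_dag e -> antisymmetric (connect e).
Proof.
move=> dag x y /andP[/connectP[p ep ->] /connectP[q ep' xq]].
suff /dag : cycle e (p ++ q) by case: p {ep ep' xq}.
by rewrite (cycle_path x) last_cat -xq cat_path ep.
Qed.

(** If A does not couple the states in S with the others, then the projection E
    onto S commutes with s I - A, hence with its inverse: so
    E (s I - A)^-1 B = (s I - A)^-1 E B, and an input for which B has no entry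
    in S has none in S in the transfer matrix either. *)
Lemma transfer_mx_decoupled (F : fieldType) (n m : nat) (A : 'M[F]_n)
    (B : 'M[F]_(n, m)) (S : {set 'I_n}) (j : 'I_m) :
  (forall r k, (r \in S) != (k \in S) -> A r k = 0) ->
  (forall r, r \in S -> B r j = 0) ->
  forall r, r \in S -> transfer_mx A B r j = 0.
Proof.
move=> AS BS r rS.
pose M := char_frac_mx A.
pose E : 'M[{fraction {poly F}}]_n := diag_mx (\row_i (i \in S)%:R).
have ME : E *m M = M *m E.
  apply/matrixP => p q; rewrite mul_diag_mx mul_mx_diag !mxE.
  have [->|_] := eqVneq p q; first by rewrite mulrC.
  have [->|pq] := eqVneq (p \in S) (q \in S); first by rewrite mulrC.
  by rewrite AS // mulr0n subr0 tofrac0 mulr0 mul0r.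
have VE : E *m invmx M = invmx M *m E.
  have uM : M \in unitmx := resolvent_unit A.
  by rewrite -[LHS](mulKmx uM) (mulmxA M) -ME mulmxK.
transitivity ((E *m transfer_mx A B) r j).
  by rewrite mul_diag_mx !mxE rS mul1r.
rewrite mulmxA VE -mulmxA mul_diag_mx mxE big1 // => k _.
rewrite !mxE; case: (boolP (k \in S)) => [/BS ->|_].
  by rewrite /= polyC0 tofrac0 !mulr0.
by rewrite mul0r mulr0.
Qed.

Section Locality.
Variables (R : realType) (N : network) (c : constants R N) (l : subgrid N).

Lemma acline_subgrid i j :
  acline i j -> (inl i \in val l) = (inl j \in val l).
Proof.
move=> ij; case/setUP: (valP l) => /imsetP[L Lc ->]; last first.
  by transitivity false; [|symmetry]; apply/imsetP => -[].
rewrite !(mem_imset _ _ (@inl_inj _ _)); case/imsetP: Lc => z _ ->.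
rewrite !inE /=.
exact: same_connect1r (sym_connect_sym (@acline_sym N)) _ _ ij z.
Qed.

Lemma zeta_eq0 (u : converter N -> R) i j :
  (forall e, val e = (i, j) -> u e = 0) -> zeta u i j = 0.
Proof.
by rewrite /zeta => u0; case: insubP => //= e _ /u0.
Qed.

Lemma curr_eq0 (x : state N -> R) i j :
  (forall e, val e = (i, j) \/ val e = (j, i) -> x (Curr e) = 0) ->
  curr x i j = 0.
Proof.
move=> x0; rewrite /curr.
case: insubP => [e _ ee|_]; case: insubP => [e' _ ee'|_] /=;
  by rewrite ?(x0 e (or_introl ee)) ?(x0 e' (or_intror ee')) subr0.
Qed.

(** Both ends of a line lie in the same subgrid, so the derivative of s involves
    only states on the same side of the block of l as s.  Treating the block and
    its complement together gives both off-diagonal halves of A at once. *)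
Lemma vector_field_state_local (x : state N -> R) (s : state N) :
  (forall t, (t \in state_block l) = (s \in state_block l) -> x t = 0) ->
  vector_field c x (fun=> 0) (fun=> 0) s = 0.
Proof.
have z0 (i j : bus N) : zeta (fun=> 0) i j = 0 :> R by apply: zeta_eq0.
case: s => [i|i|i|e] x0 /=.
- by apply: x0; rewrite !inE.
- rewrite x0 // !big1 ?(mulr0, subr0, addr0) //.
  + by move=> j _; rewrite z0 mulr0.
  + by move=> j _; rewrite z0 mulr0.
  + move=> j ij; rewrite !x0 ?inE ?subr0 ?mulr0 //.
    by rewrite (acline_subgrid ij).
- rewrite !big1 ?(oppr0, subr0, addr0, mulr0) // => j ij.
  apply: curr_eq0 => e eE; apply: x0; rewrite !inE.
  by case: eE => -> /=; rewrite (dcline_subgrid l ij) andbb.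
- case: e x0 => [[i j] eN] x0 /=; have /andP[ij _] := eN.
  by rewrite !x0 ?mulr0 ?subr0 ?mulr0 // !inE /= (dcline_subgrid l ij) andbb.
Qed.

(** The control inputs in the equations of a bus are those of the converters
    with an end at that bus; the line currents have none. *)
Lemma vector_field_input_local (u : converter N -> R) (s : state N) :
  (forall e, ((val e).1 \in val l) || ((val e).2 \in val l) -> u e = 0) ->
  s \in state_block l -> vector_field c (fun=> 0) u (fun=> 0) s = 0.
Proof.
move=> u0; have z1 i j : i \in val l -> zeta u i j = 0.
  by move=> il; apply: zeta_eq0 => e eE; apply: u0; rewrite eE il.
have z2 i j : j \in val l -> zeta u i j = 0.
  by move=> jl; apply: zeta_eq0 => e eE; apply: u0; rewrite eE jl orbT.
case: s => [i|i|i|e]; rewrite inE //= => il.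
- rewrite !big1 ?(mulr0, subr0, addr0) // => j _.
  + by rewrite z2 // mulr0.
  + by rewrite z1 // mulr0.
  + by rewrite mulr0.
- rewrite !big1 ?(mulr0, oppr0, subr0, addr0) // => j _.
  + by rewrite z2.
  + by rewrite z1.
  + by apply: curr_eq0.
- by case: e il => [[i j] ij] _; rewrite /= mulr0 !subr0 mulr0.
Qed.

End Locality.

Theorem lemma1 (R : realType) (N : network) (c : constants R N) :
  is_dag (@subgrid_graph N) ->
  poset_causal (@state_block N) (@input_block N) (gridA c) (gridB c).
Proof.
move=> dag; exists (connect (@subgrid_graph N)); split.
- exact: connect0.
- exact: connect_dag_anti.
- exact: connect_trans.
move=> k l kl; apply/matrixP => p q; rewrite [LHS]mxE [RHS]mxE.
have qk := enum_valP q; have pl := enum_valP p.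
move: {p q} (enum_val p) (enum_val q) pl qk => s e sl; rewrite inE => ek.
apply: (@transfer_mx_decoupled _ _ _ _ _
          [set r | enum_val r \in state_block l]); last by rewrite inE enum_rankK.
- move=> r n; rewrite [r \in _]inE [n \in _]inE mxE => rn.
  apply: (@vector_field_state_local _ _ _ l) => t tr; rewrite /unit_at.
  by case: (t =P _) tr rn => // -> ->; rewrite eqxx.
move=> r; rewrite inE mxE; apply: vector_field_input_local => e' e'l.
rewrite /unit_at enum_rankK; case: eqP e'l => // -> el.
(* A converter with its tail in k and an end in l makes l equal to k or a
   successor of k. *)
case/negP: kl; case/orP: el => [tl|hl].
  have [k' kP] := bus_subgrid (val e).1.
  by move: ek tl; rewrite !kP => /eqP -> /eqP ->; apply: connect0.
apply: connect1; apply/exists_inP; exists (val e).1 => //.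
by apply/exists_inP; exists (val e).2; last exact: (valP e).
Qed.
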